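(* There is an absolute constant $c>0$ such that the following holds. Let $H$ be an undirected graph with $m\ge 1$ edges, and let $\varepsilon\in(0,1)$. For every graph $A$ with finite nonempty vertex set $\mathcal X$ and density $\alpha$, the following two statements hold. (i) If $t_H(A)\ge (1+\varepsilon)^m\alpha^m$, then there exist nonempty $S,T\subseteq \mathcal X$ with $\frac{|S||T|}{|\mathcal X|^2}\ge c\,\varepsilon\,\alpha^{m+1}$ such that $$\mathbb E_{(\mathbf x,\mathbf y)\sim S\times T}[A(\mathbf x,\mathbf y)]\ge \left(1+\frac{\varepsilon}{2}\right)\alpha .$$ (ii) If $t_H(A)\le (1-\varepsilon)^m\alpha^m$, then there exist nonempty $S,T\subseteq\mathcal X$ with $\frac{|S||T|}{|\mathcal X|^2}\ge c\,\varepsilon(1-\varepsilon)^{m-1}\alpha^m$ such that $$\mathbb E_{(\mathbf x,\mathbf y)\sim S\times T}[A(\mathbf x,\mathbf y)]\le \left(1-\frac{\varepsilon}{2}\right)\alpha .$$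
   Context: A graph on a finite vertex set $\mathcal X$ is identified with a symmetric function $A:\mathcal X\times\mathcal X\to\{0,1\}$ (the indicator function of its edges). Its density is $\mathbb E[A]=\mathbb E_{\mathbf x_1,\mathbf x_2\in\mathcal X}[A(\mathbf x_1,\mathbf x_2)]$, where $\mathbf x_1,\mathbf x_2$ are uniform and independent in $\mathcal X$. For an undirected simple graph $H=([k],E_H)$, where $[k]=\{1,\dots,k\}$, define $$t_H(A)=\mathbb E_{\mathbf x_1,\dots,\mathbf x_k\in\mathcal X}\Big[\prod_{\{i,j\}\in E_H}A(\mathbf x_i,\mathbf x_j)\Big],$$ with $\mathbf x_1,\dots,\mathbf x_k$ uniform and independent in $\mathcal X$. The notation $(\mathbf x,\mathbf y)\sim S\times T$ means uniformly distributed on $S\times T$. *)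

(* Defs.v *)
From mathcomp Require Import all_boot all_order all_algebra.
From mathcomp Require Import reals.

Set Implicit Arguments.
Unset Strict Implicit.
Unset Printing Implicit Defensive.

Import Order.TTheory GRing.Theory Num.Theory.

Local Open Scope ring_scope.

(* Expectation of f at a uniformly random point of D (0 when D is empty). *)
Definition unif_expect (R : realType) (I : finType) (D : {set I}) (f : I -> R)
  : R := (\sum_(i in D) f i) / #|D|%:R.

(* A graph on X is a symmetric {0,1}-valued function, here a symmetric
   A : rel X; its booleans are cast to R with %:R.  Loops are not excluded. *)
Definition rect_density (R : realType) (X : finType) (A : rel X)
    (S T : {set X}) : R :=
  unif_expect (setX S T) (fun xy => (A xy.1 xy.2)%:R).

Definition density (R : realType) (X : finType) (A : rel X) : R :=
  rect_density R A [set: X] [set: X].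

(* For a simple graph H (symmetric and irreflexive), each undirected edge
   {i, j} is represented exactly once, by its ordered pair (i, j) with i < j. *)
Definition edges (k : nat) (H : rel 'I_k) : {set 'I_k * 'I_k} :=
  [set ij : 'I_k * 'I_k | (ij.1 < ij.2)%N && H ij.1 ij.2].

(* Independent uniform x_1, ..., x_k amount to a uniform x : {ffun 'I_k -> X}. *)
Definition hom_density (R : realType) (k : nat) (H : rel 'I_k)
    (X : finType) (A : rel X) : R :=
  unif_expect [set: {ffun 'I_k -> X}]
    (fun x => \prod_(ij in edges H) (A (x ij.1) (x ij.2))%:R).

(* Main.v *)
(** Order the edges of [H] and let [t_j] be the homomorphism density of the
    graph formed by the first [j] of them, so that [t_0 = 1] and [t_m = t_H(A)].
    The hypothesis on [t_m] yields a step [j] at which [t_(j+1) - q t_j] has the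
    right sign, [q = (1 + eps) alpha] or [(1 - eps) alpha], while [t_j] is not
    small.  If the added edge is [ab], then, all vertices other than [x_a] and
    [x_b] being fixed, the product over the first [j] edges is the indicator of
    a rectangle [x_a \in S], [x_b \in T], because [A] is {0,1}-valued.  Averaging
    over the other vertices therefore produces one rectangle on which the sum
    of [A - theta] is large in the required direction, where [theta] is the
    target density, halfway between [alpha] and [q]; this bounds both the
    density and the size of the rectangle. *)
Require Import Defs.
From mathcomp Require Import all_boot all_order all_algebra.
From mathcomp Require Import reals lra.

Set Implicit Arguments.
Unset Strict Implicit.
Unset Printing Implicit Defensive.

Import Order.TTheory GRing.Theory Num.Theory.

Local Open Scope ring_scope.

(** * Averages over a finite set *)

Section UniformExpectation.
Variables (R : realType) (I : finType).
Implicit Types (D : {set I}) (f g : I -> R).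

Lemma eq_unif_expect D f g :
  {in D, f =1 g} -> unif_expect D f = unif_expect D g.
Proof. by move=> fg; rewrite /unif_expect (eq_bigr g). Qed.

Lemma unif_expectB D f g :
  unif_expect D (fun i => f i - g i) = unif_expect D f - unif_expect D g.
Proof. by rewrite /unif_expect sumrB mulrBl. Qed.

Lemma unif_expectZ D (a : R) f :
  unif_expect D (fun i => a * f i) = a * unif_expect D f.
Proof. by rewrite /unif_expect -mulr_sumr mulrA. Qed.

Lemma unif_expect_cst D (a : R) : D != set0 -> unif_expect D (fun=> a) = a.
Proof.
move=> D0; rewrite /unif_expect sumr_const -[a *+ _]mulr_natr mulfK //.
by rewrite pnatr_eq0 cards_eq0.
Qed.

Lemma le_unif_expect D f g :
  {in D, forall i, f i <= g i} -> unif_expect D f <= unif_expect D g.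
Proof. by move=> fg; rewrite ler_wpM2r ?invr_ge0 ?ler0n // ler_sum. Qed.

Lemma exists_ge_unif_expect D f :
  D != set0 -> exists2 i, i \in D & unif_expect D f <= f i.
Proof.
move=> D0; have /set0Pn[i0 Di0] := D0.
have [i Di max_i] := arg_maxP f Di0; exists i => //.
by rewrite -[leRHS](unif_expect_cst _ D0) le_unif_expect.
Qed.

End UniformExpectation.

(** * Resampling one coordinate of a uniform point *)

Section Resampling.
Variables (R : realType) (I X : finType).
Implicit Types (x : {ffun I -> X}) (a b i : I) (u v : X).

Definition upd x a u : {ffun I -> X} := [ffun i => if i == a then u else x i].

Lemma unif_expect_upd a (f : {ffun I -> X} -> R) : (0 < #|X|)%N ->
  unif_expect [set: _] f =
  unif_expect [set: _] (fun x => unif_expect [set: X] (fun u => f (upd x a u))).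
Proof.
move=> X0; rewrite /unif_expect; congr (_ / _).
rewrite -mulr_suml; apply: (canRL (mulfK _)).
  by rewrite cardsT pnatr_eq0 -lt0n.
under [RHS]eq_bigl do rewrite in_setT.
under [RHS]eq_bigr do under eq_bigl do rewrite in_setT.
rewrite pair_big /=.
pose swap (p : {ffun I -> X} * X) := (upd p.1 a p.2, p.1 a).
have swapK : involutive swap.
  case=> x u; congr (_, _); rewrite /= ?ffunE ?eqxx //.
  by apply/ffunP=> i; rewrite !ffunE; case: eqP => [->|].
rewrite (reindex_inj (inv_inj swapK)) /=.
under [RHS]eq_bigr => p _.
  have -> : upd (upd p.1 a p.2) a (p.1 a) = p.1.
    by case: p => x u; have [] := swapK (x, u).
  over.
rewrite -(pair_big xpredT xpredT (fun x _ => f x)) /= mulr_suml.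
under [LHS]eq_bigl do rewrite in_setT.
by apply: eq_bigr => x _; rewrite sumr_const cardsT mulr_natr.
Qed.

End Resampling.

(** * Edge products, rectangles, and the choice of an edge *)

Section Rectangles.
Variables (R : realType) (k : nat) (X : finType) (A : rel X).
Hypothesis X_gt0 : (0 < #|X|)%N.
Implicit Types (E : {set 'I_k * 'I_k}) (S T : {set X}) (x : {ffun 'I_k -> X}).

Let setT_neq0 : [set: X] != set0.
Proof. by rewrite -cards_eq0 cardsT -lt0n. Qed.

Let setTf_neq0 : [set: {ffun 'I_k -> X}] != set0.
Proof. by have /set0Pn[u _] := setT_neq0; apply/set0Pn; exists [ffun=> u]. Qed.

Definition edge_prod E x : R := \prod_(ij in E) (A (x ij.1) (x ij.2))%:R.

(** Indexed by an edge set, so that edges can be deleted one at a time; at [edges H] it is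
    convertible to [hom_density R H A]. *)
Definition edge_density E : R := unif_expect [set: _] (edge_prod E).

Lemma edge_prodE E x :
  edge_prod E x = [forall ij in E, A (x ij.1) (x ij.2)]%:R.
Proof.
rewrite /edge_prod; case: forall_inP => [AE|/forall_inP].
  by rewrite big1 // => ij /AE ->.
rewrite negb_forall_in => /exists_inP[ij Eij /negbTE nA].
by rewrite (bigD1 ij) //= nA mul0r.
Qed.

Lemma edge_density0 : edge_density set0 = 1.
Proof.
rewrite -[RHS](unif_expect_cst _ setTf_neq0).
by apply: eq_unif_expect => x _; rewrite /edge_prod big_set0.
Qed.

Lemma edge_prod_ge0 E x : 0 <= edge_prod E x.
Proof. by rewrite edge_prodE ler0n. Qed.

Lemma edge_density_setD1 E e : e \in E ->
  edge_density E <= edge_density (E :\ e).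
Proof.
move=> Ee; apply: le_unif_expect => x _.
rewrite [edge_prod E x]/edge_prod (big_setD1 e) //=.
by rewrite ler_piMl ?edge_prod_ge0 // lern1 leq_b1.
Qed.

Definition away E (b : 'I_k) := [set ij in E | (ij.1 != b) && (ij.2 != b)].

(** Resample [a] and [b], then fix the best [x] for the remaining coordinates. As no edge of [E]
    joins [a] and [b], each edge avoids one of them, so the product splits into a condition on [u]
    and a condition on [v]. An edge avoiding both enters both conditions, harmlessly for an
    indicator. *)
Lemma exists_rectangle E (a b : 'I_k) (F : X -> X -> R) :
  a != b -> (a, b) \notin E -> (b, a) \notin E ->
  exists S T, unif_expect [set: _] (fun x => edge_prod E x * F (x a) (x b))
    <= (\sum_(uv in setX S T) F uv.1 uv.2) / #|X|%:R ^+ 2.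
Proof.
move=> ab Eab Eba.
rewrite (unif_expect_upd b) // (unif_expect_upd a) //.
set G := fun x => _.
have [x _ Gx] := exists_ge_unif_expect G setTf_neq0.
pose S := [set u | [forall ij in away E b, A (upd x a u ij.1) (upd x a u ij.2)]].
pose T := [set v | [forall ij in away E a, A (upd x b v ij.1) (upd x b v ij.2)]].
exists S, T; apply: le_trans Gx _.
have prodST u v : edge_prod E (upd (upd x a u) b v) = ((u \in S) && (v \in T))%:R.
  rewrite edge_prodE; congr (nat_of_bool _)%:R; rewrite !inE.
  apply/forall_inP/andP => [AE|[/forall_inP AS /forall_inP AT] [i j] Eij].
    split; apply/forall_inP => -[i j]; rewrite inE /= => /and3P[Eij ni nj];
      have := AE _ Eij; rewrite /= !ffunE.
      by rewrite (negPf ni) (negPf nj).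
    by rewrite (negPf ni) (negPf nj).
  have [nb|] := boolP ((i != b) && (j != b)).
    have := AS (i, j); rewrite inE /= Eij nb => /(_ isT); rewrite !ffunE.
    by case/andP: nb => /negPf-> /negPf->.
  (* An edge through [b] cannot also meet [a], so the condition defining [T] covers it. *)
  move=> isb; have na : (i != a) && (j != a).
    move: isb; rewrite negb_and !negbK => /orP[]/eqP eb; subst.
      rewrite eq_sym ab /=; apply: contraNneq Eba => <- //.
    rewrite [b == a]eq_sym ab andbT; apply: contraNneq Eab => <- //.
  have := AT (i, j); rewrite inE /= Eij na => /(_ isT); rewrite !ffunE.
  by case/andP: na => /negPf-> /negPf->.
have upd_ab u v : (upd (upd x a u) b v a = u) * (upd (upd x a u) b v b = v).
  by rewrite !ffunE !eqxx (negPf ab).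
rewrite /G /unif_expect -mulr_suml -mulrA -invfM cardsT -expr2.
have -> : \sum_(uv in setX S T) F uv.1 uv.2 = \sum_(u in S) \sum_(v in T) F u v.
  by rewrite pair_big; apply: eq_bigl => uv; rewrite !inE.
rewrite [in leRHS]big_mkcond /=.
rewrite le_eqVlt; apply/orP; left; apply/eqP; congr (_ / _).
under eq_bigl do rewrite in_setT.
apply: eq_bigr => u _; under eq_bigl do rewrite in_setT.
under eq_bigr => v _ do rewrite prodST !upd_ab.
case: (u \in S) => /=; last by rewrite big1 // => v _; rewrite mul0r.
rewrite [RHS]big_mkcond; apply: eq_bigr => v _.
by case: (v \in T); rewrite ?mul1r ?mul0r.
Qed.

(** The sign [s] serves both halves of the theorem. Take [F = s * (A - theta)] in
    [exists_rectangle]: since [F <= 1], its sum over the rectangle is at most [#|S| * #|T|], which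
    gives the size. That sum is positive, which gives nonemptiness and the bias. *)
Lemma exists_biased_rectangle E (e : 'I_k * 'I_k) (s theta d : R) :
  {in E, forall ij : 'I_k * 'I_k, (ij.1 < ij.2)%N} -> e \in E ->
  (forall u v, s * ((A u v)%:R - theta) <= 1) ->
  0 < d -> d <= s * (edge_density E - theta * edge_density (E :\ e)) ->
  exists S T, [/\ S != set0, T != set0,
    d <= (#|S|%:R * #|T|%:R) / #|X|%:R ^+ 2
    & 0 <= s * (rect_density R A S T - theta)].
Proof.
case: e => a b ltE Eab le1 d0 dE.
have ab : a != b by apply/eqP => ab; have := ltE _ Eab; rewrite /= ab ltnn.
have [] := @exists_rectangle (E :\ (a, b)) a b
    (fun u v => s * ((A u v)%:R - theta)) ab.
- by rewrite !inE eqxx.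
(* The reversed pair is absent because edges are stored increasingly. *)
- rewrite !inE negb_and negbK orbC; apply/orP; left; apply/negP => /ltE /=.
  by rewrite ltnNge ltnW // (ltE _ Eab).
move=> S [T]; rewrite (@eq_unif_expect _ _ _ _
    (fun x => s * (edge_prod E x - theta * edge_prod (E :\ (a, b)) x))); last first.
  move=> x _; rewrite [edge_prod E x]/edge_prod (big_setD1 (a, b)) //=.
  rewrite -/(edge_prod _ x); lra.
rewrite unif_expectZ unif_expectB unif_expectZ => /(le_trans dE).
set F := \sum_(uv in _) _ => dF.
have N0 : 0 < #|X|%:R ^+ 2 :> R by rewrite exprn_gt0 // ltr0n.
have F0 : 0 < F
  by have := lt_le_trans d0 dF; rewrite pmulr_lgt0 ?invr_gt0.
have FST : F <= #|S|%:R * #|T|%:R.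
  by rewrite -natrM -cardsX -sumr_const ler_sum.
have ST0 : 0 < #|S|%:R * #|T|%:R :> R by apply: lt_le_trans FST.
exists S, T; split.
- by apply: contraTneq ST0 => ->; rewrite cards0 mul0r ltxx.
- by apply: contraTneq ST0 => ->; rewrite cards0 mulr0 ltxx.
- by apply: le_trans dF _; rewrite ler_pM2r ?invr_gt0.
- rewrite -(pmulr_lge0 _ ST0).
  suff -> : s * (rect_density R A S T - theta) * (#|S|%:R * #|T|%:R) = F.
    exact: ltW.
  rewrite /F -mulr_sumr sumrB sumr_const -[theta *+ _]mulr_natr cardsX natrM.
  rewrite /rect_density /unif_expect cardsX natrM.
  by rewrite -mulrA mulrBl divfK // gt_eqF.
Qed.

(** If deleting [e] fails the ratio test, dividing by [q] preserves the hypothesis for [E :\ e]. A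
    single edge passes, the empty product having density 1. The exponent is [#|E'|] because the last
    bound only uses that deletion does not decrease the density. *)
Lemma exists_edge_above (q : R) E : 0 < q -> (0 < #|E|)%N ->
  q ^+ #|E| <= edge_density E ->
  exists E' e, [/\ E' \subset E, e \in E',
    q * edge_density (E' :\ e) <= edge_density E'
    & q ^+ #|E'| <= edge_density (E' :\ e)].
Proof.
move=> q0; move: {2}#|E| (leqnn #|E|) => n.
elim: n E => [|n IHn] E; first by rewrite leqn0 => /eqP->.
move=> En E0 qE; have /set0Pn[e Ee] : E != set0 by rewrite -card_gt0.
have Ee1 : #|E| = #|E :\ e|.+1 by rewrite (cardsD1 e) Ee.
have [qle|/ltW qge] := leP (q * edge_density (E :\ e)) (edge_density E).
  by exists E, e; split=> //; apply: le_trans qE (edge_density_setD1 Ee).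
have qEe : q ^+ #|E :\ e| <= edge_density (E :\ e).
  by rewrite -(ler_pM2l q0) -exprS -Ee1; apply: le_trans qge.
have [Ee0|Ee0] := posnP #|E :\ e|.
  exists E, e; split=> //; last exact: le_trans qE (edge_density_setD1 Ee).
  move: qE; rewrite Ee1 Ee0 expr1; move/eqP: Ee0; rewrite cards_eq0 => /eqP->.
  by rewrite edge_density0 mulr1.
have [|E' [e' [sE' E'e' h1 h2]]] := IHn (E :\ e) _ Ee0 qEe.
  by rewrite -ltnS -Ee1.
by exists E', e'; split=> //; apply: subset_trans sE' (subsetDl _ _).
Qed.

(** Delete edges while the density stays below the matching power of [q]; this stops before the
    empty set, where both are 1. At the stop, [q ^+ #|E'| = q * q ^+ #|E'|.-1] gives the ratio
    bound. *)
Lemma exists_edge_below (q : R) E : 0 < q -> (0 < #|E|)%N ->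
  edge_density E <= q ^+ #|E| ->
  exists E' e, [/\ E' \subset E, e \in E',
    edge_density E' <= q * edge_density (E' :\ e)
    & q ^+ #|E'|.-1 <= edge_density (E' :\ e)].
Proof.
move=> q0; move: {2}#|E| (leqnn #|E|) => n.
elim: n E => [|n IHn] E; first by rewrite leqn0 => /eqP->.
move=> En E0 qE; have /set0Pn[e Ee] : E != set0 by rewrite -card_gt0.
have Ee1 : #|E| = #|E :\ e|.+1 by rewrite (cardsD1 e) Ee.
have [qge|qlt] := leP (q ^+ #|E :\ e|) (edge_density (E :\ e)).
  exists E, e; split=> //; last by rewrite Ee1.
  by apply: le_trans qE _; rewrite Ee1 exprS ler_pM2l.
have [Ee0|Ee0] := posnP #|E :\ e|.
  move: qlt; rewrite Ee0; move/eqP: Ee0; rewrite cards_eq0 => /eqP->.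
  by rewrite edge_density0 expr0 ltxx.
have [|E' [e' [sE' E'e' h1 h2]]] := IHn (E :\ e) _ Ee0 (ltW qlt).
  by rewrite -ltnS -Ee1.
by exists E', e'; split=> //; apply: subset_trans sE' (subsetDl _ _).
Qed.

Lemma density_bounds : 0 <= density R A <= 1.
Proof.
have XX0 : setX [set: X] [set: X] != set0.
  by rewrite -card_gt0 cardsX cardsT muln_gt0 X_gt0.
rewrite /density /rect_density -[in X in X <= _ <= _](unif_expect_cst 0 XX0).
rewrite -[in X in _ <= _ <= X](unif_expect_cst 1 XX0).
by rewrite !le_unif_expect // => uv _; rewrite ?ler0n // lern1 leq_b1.
Qed.

Lemma full_rectangle_size :
  (#|[set: X]|%:R * #|[set: X]|%:R) / #|X|%:R ^+ 2 = 1 :> R.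
Proof. by rewrite cardsT -expr2 divff // expf_eq0 /= pnatr_eq0 -lt0n. Qed.

End Rectangles.

Theorem theorem1p3 (R : realType) :
  exists c : R, 0 < c /\
  forall (k : nat) (H : rel 'I_k) (m : nat) (eps : R),
    symmetric H -> irreflexive H -> #|edges H| = m -> (1 <= m)%N ->
    0 < eps -> eps < 1 ->
  forall (X : finType) (A : rel X) (alpha : R),
    (0 < #|X|)%N -> symmetric A -> density R A = alpha ->
    ((1 + eps) ^+ m * alpha ^+ m <= hom_density R H A ->
      exists S T : {set X},
        [/\ S != set0, T != set0,
            c * eps * alpha ^+ m.+1
              <= (#|S|%:R * #|T|%:R) / #|X|%:R ^+ 2
          & (1 + eps / 2) * alpha <= rect_density R A S T])
    /\
    (hom_density R H A <= (1 - eps) ^+ m * alpha ^+ m ->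
      exists S T : {set X},
        [/\ S != set0, T != set0,
            c * eps * (1 - eps) ^+ m.-1 * alpha ^+ m
              <= (#|S|%:R * #|T|%:R) / #|X|%:R ^+ 2
          & rect_density R A S T <= (1 - eps / 2) * alpha]).
Proof.
(* The target density lies [eps * alpha / 2] away from [q]; this is the source of 1/2. *)
exists (1 / 2); split; first by lra.
move=> k H m eps _ _ Hm m0 e0 e1 X A alpha X0 _ dA.
have := density_bounds R A X0; rewrite dA => /andP[a0 a1].
have X_neq0 : [set: X] != set0 by rewrite -card_gt0 cardsT.
have ltH : {in edges H, forall ij : 'I_k * 'I_k, (ij.1 < ij.2)%N}.
  by move=> ij; rewrite inE => /andP[].
have bounds (E : {set 'I_k * 'I_k}) : E \subset edges H ->
    {in E, forall ij : 'I_k * 'I_k, (ij.1 < ij.2)%N} /\ (#|E| <= m)%N.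
  move=> sE; split; last by rewrite -Hm subset_leq_card.
  by move=> ij /(subsetP sE)/ltH.
(* For [alpha = 0] both size bounds vanish, since [m >= 1], and the full rectangle works. *)
move: a0; rewrite le_eqVlt => /predU1P[alpha0|a0].
  split=> _; exists [set: X], [set: X]; split=> //;
    rewrite ?full_rectangle_size //;
    rewrite -?/(density R A) ?dA -?alpha0 ?mulr0 // expr0n ?mulr0 ?ler01 //.
  by rewrite eqn0Ngt m0 mulr0 ler01.
have A01 u v : 0 <= ((A u v)%:R : R) <= 1 by rewrite ler0n lern1 leq_b1.
have ea0 : 0 < eps * alpha by rewrite mulr_gt0.
have ea1 : eps * alpha < alpha by rewrite -[ltRHS]mul1r ltr_pM2r.
split; rewrite -exprMn => tH.
- have q0 : 0 < (1 + eps) * alpha by lra.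
  have [||E [e [sE Ee qE tE]]] :=
      exists_edge_above X0 q0 (A := A) (E := edges H); rewrite ?Hm //.
  have [ltE Em] := bounds _ sE.
  (* Here [q] may exceed 1, so it is lowered to [alpha <= 1] before raising the exponent to [m]. *)
  have tE' : alpha ^+ m <= edge_density R A (E :\ e).
    apply: le_trans tE; apply: (@le_trans _ _ (alpha ^+ #|E|)).
      by rewrite ler_wiXn2l // ltW.
    by rewrite lerXn2r ?nnegrE //; lra.
  have [|||S [T [S0 T0 ST dST]]] :=
    exists_biased_rectangle X0 ltE Ee (A := A)
      (s := 1) (theta := (1 + eps / 2) * alpha)
      (d := 1 / 2 * eps * alpha ^+ m.+1).
  + by move=> u v; have /andP[] := A01 u v; lra.
  + by rewrite !mulr_gt0 ?exprn_gt0 //; lra.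
  + have := ler_wpM2l (ltW ea0) tE'; rewrite exprS; lra.
  by exists S, T; split=> //; lra.
- have q0 : 0 < (1 - eps) * alpha by lra.
  have [||E [e [sE Ee qE tE]]] :=
      exists_edge_below X0 q0 (A := A) (E := edges H); rewrite ?Hm //.
  have [ltE Em] := bounds _ sE.
  (* Now [q <= 1], so the exponent rises to [m.-1] with the factor [1 - eps] kept. *)
  have tE' : ((1 - eps) * alpha) ^+ m.-1 <= edge_density R A (E :\ e).
    apply: le_trans tE; rewrite ler_wiXn2l ?(ltW q0) //; first by lra.
    by rewrite -!subn1 leq_sub2r.
  have [|||S [T [S0 T0 ST dST]]] :=
    exists_biased_rectangle X0 ltE Ee (A := A)
      (s := -1) (theta := (1 - eps / 2) * alpha)
      (d := 1 / 2 * eps * (1 - eps) ^+ m.-1 * alpha ^+ m).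
  + by move=> u v; have /andP[] := A01 u v; lra.
  + by rewrite !mulr_gt0 ?exprn_gt0 //; lra.
  + have := ler_wpM2l (ltW ea0) tE'; rewrite -[in alpha ^+ m](prednK m0) exprS exprMn.
    lra.
  by exists S, T; split=> //; lra.
Qed.
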